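(* Fix $\lambda>0$. Any deterministic or probabilistic $\epsilon n$-approximation algorithm for $\log Z(G,\lambda)$ needs $\Omega(1/\epsilon^2)$ queries on average, assuming $\epsilon>C/\sqrt{n}$ for some constant $C$.
   Context: For a finite undirected graph $G$ with $n$ vertices, $Z(G,\lambda)=\sum_{M}\lambda^{|M|}$, summing over all matchings $M$ of $G$ (edge sets no two sharing an endpoint). The graph is accessed via oracles $\mathcal{D}(u)$ (degree of $u$) and $\mathcal{N}(u,i)$ ($i$-th neighbor of $u$); a query is one oracle call. An $\epsilon n$-approximation algorithm for $\log Z(G,\lambda)$ outputs, for every input graph, a value within additive error $\epsilon n$ of $\log Z(G,\lambda)$ with probability at least $2/3$. *)

(* Defs.v *)
From HB Require Import structures.
From mathcomp Require Import all_boot all_order all_algebra.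
From mathcomp Require Import all_classical all_reals all_analysis measurable_realfun.
Set Implicit Arguments. Unset Strict Implicit. Unset Printing Implicit Defensive.
Import Order.TTheory GRing.Theory Num.Theory.
Local Open Scope ring_scope.

(* An input graph on vertex set 'I_n is given by its adjacency lists:
   L u = the list of neighbours of u, in the order the oracle N(u,.) reports them.
   Valid inputs: finite simple undirected graphs (no loops, no repeated
   neighbours, symmetric adjacency). *)
Definition adj_list (n : nat) := 'I_n -> seq 'I_n.

Definition valid_input (n : nat) (L : adj_list n) : Prop :=
  (forall u, uniq (L u)) /\ (forall u, u \notin L u) /\
  (forall u v, (v \in L u) = (u \in L v)).

Definition is_matching (n : nat) (L : adj_list n) (M : {set {set 'I_n}}) : bool :=
  [forall e in M, exists u, exists v, (v \in L u) && (e == [set u; v])]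
  && finset.trivIset M.

Definition Zmatch (R : numFieldType) (n : nat) (L : adj_list n) (lam : R) : R :=
  \sum_(M : {set {set 'I_n}} | is_matching L M) lam ^+ #|M|.

(* Degree oracle D(u) and neighbour oracle N(u,i) (i is 0-based; an index out
   of range is answered with None). *)
Inductive query (n : nat) := QDeg of 'I_n | QNbr of 'I_n & nat.
Inductive answer (n : nat) := ADeg of nat | ANbr of option 'I_n.

Definition oracle (n : nat) (L : adj_list n) (q : query n) : answer n :=
  match q with
  | QDeg u => ADeg n (size (L u))
  | QNbr u i => ANbr (nth None (map Some (L u)) i)
  end.

(* A deterministic adaptive query algorithm: given the transcript so far,
   either asks a new query or stops with a real output. *)
Inductive action (n : nat) (R : Type) := Ask of query n | Out of R.

Definition det_alg (n : nat) (R : Type) :=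
  seq (query n * answer n) -> action n R.

Fixpoint exec (n : nat) (R : Type) (A : det_alg n R) (L : adj_list n) (k : nat)
  : seq (query n * answer n) :=
  match k with
  | 0 => [::]
  | k'.+1 => let h := exec A L k' in
             match A h with
             | Ask q => rcons h (q, oracle L q)
             | Out _ => h
             end
  end.

Definition halted (n : nat) (R : Type) (A : det_alg n R) (L : adj_list n) (k : nat) : bool :=
  if A (exec A L k) is Out _ then true else false.

Definition qcount (n : nat) (R : realType) (A : det_alg n R) (L : adj_list n) : \bar R :=
  match boolp.pselect (exists k, halted A L k) with
  | left h => ((ex_minn h)%:R)%:E
  | right _ => (+oo)%E
  end.

Definition good_output (n : nat) (R : realType) (A : det_alg n R) (L : adj_list n)
  (lam eps : R) : Prop :=
  exists k r, A (exec A L k) = Out n r /\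
              `| r - ln (Zmatch L lam) | <= eps * n%:R.

(* Main.v *)
Require Import Defs.
From HB Require Import structures.
From mathcomp Require Import all_boot all_order all_algebra.
From mathcomp Require Import ring lra zify.
From mathcomp Require Import all_classical all_reals all_analysis measurable_realfun.
Set Implicit Arguments. Unset Strict Implicit. Unset Printing Implicit Defensive.
Import Order.TTheory GRing.Theory Num.Theory.
Local Open Scope ring_scope.

(** Take [m = n./2] disjoint pairs of vertices and join the [i]-th pair by an edge
    according to a bit [x i], so that [ln Z] is [ln (1 + lam)] times the number of
    ones of [x], and every query reads at most one bit.  Draw the bits independently
    with bias [+delta] or [-delta], where [delta] is a large constant times [eps].
    As [delta^2 * n] is large, the number of ones concentrates (Chebyshev), and an
    [eps n]-approximation then tells the two biases apart.  But the likelihood ratio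
    against unbiased bits of what [T] adaptive reads reveal has second moment at most
    [(1 + 4 delta^2)^T], so for [T] a small constant times [1 / eps^2] no test
    succeeds with the required probability.  Markov's inequality reduces the expected
    number of queries to such a [T], and averaging over the bits handles randomised
    algorithms. *)

(** * Independent random bits: adaptive reading and concentration *)

Section BitVectors.
Variables (R : realFieldType) (m : nat).
Implicit Types (u : 'I_m -> bool -> R) (x : {ffun 'I_m -> bool})
  (f g : {ffun 'I_m -> bool} -> R).

Definition weight u (x : {ffun 'I_m -> bool}) : R := \prod_i u i (x i).

Definition mean u f : R := \sum_x weight u x * f x.

(** Conditioning on the [i]-th bit: its factor becomes a Dirac mass at [b]. *)
Definition pin u (i : 'I_m) (b : bool) : 'I_m -> bool -> R :=
  fun j c => if j == i then (c == b)%:R else u j c.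

Lemma mean_prod u (F : 'I_m -> bool -> R) :
  mean u (fun x => \prod_i F i (x i)) =
  \prod_i (u i true * F i true + u i false * F i false).
Proof.
under [RHS]eq_bigr => i _ do rewrite -(big_bool _ (fun b => u i b * F i b)).
rewrite bigA_distr_bigA /mean; apply: eq_bigr => x _.
by rewrite big_split.
Qed.

Lemma mean1 u : (forall i, u i true + u i false = 1) -> mean u (fun=> 1) = 1.
Proof.
move=> u1; transitivity (mean u (fun=> \prod_(i < m) 1)).
  by apply: eq_bigr => x _; rewrite big1.
rewrite (mean_prod u (fun _ _ => 1)) big1 // => i _.
by rewrite !mulr1 u1.
Qed.

Lemma weight_ge0 u x : (forall i b, 0 <= u i b) -> 0 <= weight u x.
Proof. by move=> u0; apply: prodr_ge0. Qed.

Lemma le_mean u f g : (forall i b, 0 <= u i b) -> (forall x, f x <= g x) ->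
  mean u f <= mean u g.
Proof.
by move=> u0 fg; apply: ler_sum => x _; apply: ler_wpM2l => //; apply: weight_ge0.
Qed.

Lemma meanD u f g : mean u (fun x => f x + g x) = mean u f + mean u g.
Proof. by rewrite -big_split; apply: eq_bigr => x _; rewrite mulrDr. Qed.

Lemma meanZ u a f : mean u (fun x => a * f x) = a * mean u f.
Proof. by rewrite mulr_sumr; apply: eq_bigr => x _; rewrite mulrCA. Qed.

Lemma mean_sum u (I : finType) (F : I -> {ffun 'I_m -> bool} -> R) :
  mean u (fun x => \sum_i F i x) = \sum_i mean u (F i).
Proof.
by rewrite exchange_big; apply: eq_bigr => x _; rewrite mulr_sumr.
Qed.

Lemma eq_mean u f g : f =1 g -> mean u f = mean u g.
Proof. by move=> fg; apply: eq_bigr => x _; rewrite fg. Qed.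

Lemma eq_mean_weight u v f : (forall i b, u i b = v i b) -> mean u f = mean v f.
Proof.
by move=> uv; apply: eq_bigr => x _; congr (_ * _); apply: eq_bigr => i _.
Qed.

Lemma weight_pin u i x : weight u x = u i (x i) * weight (pin u i (x i)) x.
Proof.
rewrite /weight (bigD1 i) //= [in RHS](bigD1 i) //= /pin !eqxx mul1r.
by congr (_ * _); apply: eq_bigr => j /negPf ->.
Qed.

Lemma weight_pin_neq u i b x : x i != b -> weight (pin u i b) x = 0.
Proof.
by move=> /negPf xb; rewrite /weight (bigD1 i) //= /pin eqxx xb mul0r.
Qed.

(** Law of total probability on bit [i]. [F] receives the bit separately, to hold the continuation
    that an adaptive reader chooses after seeing it. *)
Lemma mean_read u i (F : bool -> {ffun 'I_m -> bool} -> R) :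
  mean u (fun x => F (x i) x) =
  u i true * mean (pin u i true) (F true) + u i false * mean (pin u i false) (F false).
Proof.
rewrite /mean !mulr_sumr -big_split; apply: eq_bigr => x _ /=.
rewrite (weight_pin u i x); case xi: (x i).
  by rewrite (@weight_pin_neq u i false x) ?xi// mul0r mulr0 addr0 mulrA.
by rewrite (@weight_pin_neq u i true x) ?xi// mul0r mulr0 add0r mulrA.
Qed.

Definition bias (d : R) : 'I_m -> bool -> R :=
  fun _ b => 2^-1 + (if b then d else - d).

(* [bias d] conditioned on the bits [i] with [pins i = Some c] being equal to [c]. *)
Definition cond_bias (d : R) (pins : 'I_m -> option bool) : 'I_m -> bool -> R :=
  fun i b => if pins i is Some c then (b == c)%:R else bias d i b.

Lemma bias_ge0 d i b : `|d| <= 2^-1 -> 0 <= bias d i b.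
Proof. by rewrite ler_norml => /andP[? ?]; case: b; rewrite /bias; lra. Qed.

Lemma bias_sum d i : bias d i true + bias d i false = 1.
Proof. by rewrite /bias; lra. Qed.

Lemma cond_bias_sum d pins i : cond_bias d pins i true + cond_bias d pins i false = 1.
Proof. by rewrite /cond_bias; case: (pins i) => [[]|]; rewrite ?bias_sum//=; lra. Qed.

Lemma pin_cond_bias d pins i b j c :
  pin (cond_bias d pins) i b j c =
  cond_bias d (fun k => if k == i then Some b else pins k) j c.
Proof. by rewrite /pin /cond_bias; case: eqP. Qed.

(* [l] is the likelihood ratio of [bias d] against [bias 0] accumulated so far: its
   second moment grows by the factor [1 + 4 d^2] with each freshly read bit, and
   AM-GM turns the second moment of [l - 1] into a bound on total variation. *)
Lemma adaptive_reading_cond (S : Type) (step : {ffun 'I_m -> bool} -> S -> S)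
    (D : S -> bool) (d t : R) :
  (forall s, exists i (g : bool -> S), forall x, step x s = g (x i)) ->
  0 < t ->
  forall k s pins (l : R),
  l * mean (cond_bias d pins) (fun x => (D (iter k (step x) s))%:R)
    - mean (cond_bias 0 pins) (fun x => (D (iter k (step x) s))%:R)
  <= t / 2 * (l ^+ 2 * (1 + 4 * d ^+ 2) ^+ k - 2 * l + 1) + (2 * t)^-1.
Proof.
move=> one_bit t0; elim=> [|k IH] s pins l.
  have E v : (forall i, v i true + v i false = 1) ->
      mean v (fun=> (D s)%:R) = (D s)%:R.
    move=> v1; rewrite (@eq_mean _ _ (fun x => (D s)%:R * 1)) => [|x]; last by rewrite mulr1.
    by rewrite meanZ mean1 ?mulr1.
  rewrite /= !E; try exact: cond_bias_sum.
  rewrite expr0 mulr1.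
  (* With no step left the claim is [(l - 1) * D s <= t / 2 * (l - 1)^2 + 1 / (2 * t)]: this square
     settles it if [D s] holds, the next one if not. *)
  have : 0 <= (2 * t)^-1 * (t * (l - 1) - 1) ^+ 2.
    by rewrite mulr_ge0 ?sqr_ge0// invr_ge0; lra.
  have : 0 <= (2 * t)^-1 * (t * (l - 1)) ^+ 2.
    by rewrite mulr_ge0 ?sqr_ge0// invr_ge0; lra.
  have tn0 : t != 0 by rewrite gt_eqF.
  have : 0 < (2 * t)^-1 by rewrite invr_gt0; lra.
  have -> : (2 * t)^-1 * (t * (l - 1) - 1) ^+ 2 =
     t / 2 * (l ^+ 2 - 2 * l + 1) - (l - 1) + (2 * t)^-1 by field.
  have -> : (2 * t)^-1 * (t * (l - 1)) ^+ 2 =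
     t / 2 * (l ^+ 2 - 2 * l + 1) by field.
  by case: (D s) => /=; lra.
have [i [g gE]] := one_bit s.
have E v : mean v (fun x => (D (iter k.+1 (step x) s))%:R) =
   v i true * mean (pin v i true) (fun x => (D (iter k (step x) (g true)))%:R) +
   v i false * mean (pin v i false) (fun x => (D (iter k (step x) (g false)))%:R).
  rewrite -(mean_read v i (fun b x => (D (iter k (step x) (g b)))%:R)).
  by apply: eq_mean => x; rewrite iterSr gE.
rewrite !E; do 4 (rewrite (eq_mean_weight _ (pin_cond_bias _ _ _ _))).
have q0 : 1 <= 1 + 4 * d ^+ 2 by have := sqr_ge0 d; lra.
set p := 1 + 4 * d ^+ 2 in q0 *.
have qk : 1 <= p ^+ k by rewrite exprn_ege1.
have pE : p = 1 + 4 * d ^+ 2 by [].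
rewrite [p ^+ k.+1]exprS.
move: (IH (g true) (fun k => if k == i then Some true else pins k)).
move: (IH (g false) (fun k => if k == i then Some false else pins k)).
set at_ := mean _ _; set bt := mean _ _; set af := mean _ _; set bf := mean _ _.
rewrite -/p; clearbody p; move: (p ^+ k) qk => pk qk.
rewrite /cond_bias; case: (pins i) => [c|] H1 H2.
  (* Rereading a pinned bit keeps [l]; the extra factor [p] only loosens the bound. *)
  have l2 : 0 <= t / 2 * (l ^+ 2 * pk * (p - 1)).
    rewrite mulr_ge0 ?divr_ge0 ?(ltW t0)// mulr_ge0 ?subr_ge0//.
    by rewrite mulr_ge0 ?sqr_ge0// (le_trans ler01).
  case: c => /=.
    by move: (H2 l) l2; lra.
  by move: (H1 l) l2; lra.
(* A fresh bit multiplies [l] by [1 + 2 * d] or [1 - 2 * d]; under fair bits these have mean [1] and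
   mean square [1 + 4 * d^2]. *)
have := H2 (l * (1 + 2 * d)); have := H1 (l * (1 - 2 * d)).
rewrite pE /bias; lra.
Qed.

(** Initially nothing is pinned and the likelihood ratio is [1]. The parameter [t] balances the two
    error terms. *)
Lemma adaptive_reading (S : Type) (step : {ffun 'I_m -> bool} -> S -> S)
    (D : S -> bool) (d t : R) k s :
  (forall s, exists i (g : bool -> S), forall x, step x s = g (x i)) ->
  0 < t ->
  mean (bias d) (fun x => (D (iter k (step x) s))%:R)
  <= mean (bias 0) (fun x => (D (iter k (step x) s))%:R)
     + t / 2 * ((1 + 4 * d ^+ 2) ^+ k - 1) + (2 * t)^-1.
Proof.
move=> one_bit t0.
have := @adaptive_reading_cond S step D d t one_bit t0 k s (fun=> None) 1.
rewrite mul1r expr1n mul1r -[cond_bias d _]/(bias d) -[cond_bias 0 _]/(bias 0).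
set a := mean _ _; set b := mean _ _; lra.
Qed.

Definition ones (x : {ffun 'I_m -> bool}) : nat := #|[pred i | x i]|.

Lemma ones_sum x : (ones x)%:R = \sum_i (x i)%:R :> R.
Proof.
rewrite /ones -sum1_card natr_sum big_mkcond; apply: eq_bigr => i _ /=.
by rewrite inE; case: (x i).
Qed.

(** Expand the square: independence kills the cross terms, and each diagonal term is [1/4 - d^2]. *)
Lemma variance_ones d :
  mean (bias d) (fun x => ((ones x)%:R - m%:R * (2^-1 + d)) ^+ 2) <= m%:R / 4.
Proof.
pose Y (b : bool) : R := b%:R - (2^-1 + d).
have -> : mean (bias d) (fun x => ((ones x)%:R - m%:R * (2^-1 + d)) ^+ 2) =
    \sum_i \sum_j mean (bias d) (fun x => Y (x i) * Y (x j)).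
  under [RHS]eq_bigr => i _ do rewrite -mean_sum.
  rewrite -mean_sum; apply: eq_mean => x.
  under [RHS]eq_bigr => i _ do rewrite -mulr_sumr.
  rewrite -mulr_suml -expr2; congr (_ ^+ 2).
  by rewrite sumrB sumr_const card_ord mulr_natl ones_sum.
have YY i j : mean (bias d) (fun x => Y (x i) * Y (x j)) =
    if i == j then 4^-1 - d ^+ 2 else 0.
  (* Writing [Y (x i) * Y (x j)] as a product over all bits lets [mean_prod] treat [i = j] and
     [i != j] together. *)
  pose F k b := (if k == i then Y b else 1) * (if k == j then Y b else 1).
  rewrite (@eq_mean _ _ (fun x => \prod_k F k (x k))); last first.
    by move=> x; rewrite big_split -!big_mkcond !big_pred1_eq.
  rewrite mean_prod (bigD1 i) //= /F eqxx.
  have [->|ij] := eqVneq i j; last first.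
    by rewrite /bias /Y /= !mulr1 -[RHS](mul0r (\prod_(k | k != i) 
      (bias d k true * F k true + bias d k false * F k false))); congr (_ * _); field.
  rewrite big1 ?mulr1; first by rewrite /bias /Y /=; field.
  by move=> k /negPf kj; rewrite kj !mulr1 bias_sum.
under eq_bigr => i _.
  under eq_bigr => j _ do rewrite YY.
  rewrite -big_mkcond (eq_bigl (pred1 i)) ?big_pred1_eq; last by move=> j; rewrite eq_sym.
  over.
rewrite sumr_const card_ord -[leLHS]mulr_natl ler_wpM2l//.
by have := sqr_ge0 d; lra.
Qed.

Lemma chebyshev_ones (d s : R) : `|d| <= 2^-1 -> 0 < s ->
  mean (bias d) (fun x => (s <= `|(ones x)%:R - m%:R * (2^-1 + d)|)%R%:R)
  <= m%:R / (4 * s ^+ 2).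
Proof.
move=> d2 s0; have s2 : 0 < s ^+ 2 by rewrite exprn_gt0.
rewrite -(ler_pM2l s2) -meanZ.
have -> : s ^+ 2 * (m%:R / (4 * s ^+ 2)) = m%:R / 4 by field; rewrite gt_eqF.
apply: le_trans (variance_ones d); apply: le_mean => [i b|x]; first exact: bias_ge0.
case: (lerP s) => [sx|_]; last by rewrite mulr0 sqr_ge0.
by rewrite mulr1 -[leRHS]real_normK ?num_real// lerXn2r// nnegrE ltW.
Qed.

End BitVectors.

(** Division-free form of [(1 + x)^k <= 1 / (1 - k * x)]; the induction rests on
    [(1 + x) * (1 - (k + 1) * x) <= 1 - k * x]. *)
Lemma expr1D_mul_le1 (R : realFieldType) (x : R) k :
  0 <= x -> (1 + x) ^+ k * (1 - k%:R * x) <= 1.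
Proof.
move=> x0; elim: k => [|k IH]; first by rewrite expr0 mul0r; lra.
apply: le_trans IH; rewrite exprSr -mulrA ler_wpM2l//.
  by rewrite exprn_ge0//; lra.
have : 0 <= k%:R * x ^+ 2 by rewrite mulr_ge0 ?sqr_ge0.
have := sqr_ge0 x; rewrite -natr1; lra.
Qed.

(** Expand the product of the [F i + 1], where [F] is [lam] on [E] and [0] elsewhere: each [M]
    collects the factors from which [F i] is taken. *)
Lemma sum_powerset (R : comNzRingType) (T : finType) (E : {set T}) (lam : R) :
  \sum_(M : {set T} | M \subset E) lam ^+ #|M| = (1 + lam) ^+ #|E|.
Proof.
pose F i : R := if i \in E then lam else 0.
have := bigA_distr 1 +%R F (fun=> 1).
have -> : \prod_i (F i + 1) = (1 + lam) ^+ #|E|.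
  rewrite (bigID (mem E)) /= [X in _ * X]big1 ?mulr1.
    by rewrite -prodr_const; apply: eq_bigr => i iE; rewrite /F iE addrC.
  by move=> i /negPf iE; rewrite /F iE add0r.
move=> ->; rewrite big_mkcond; apply: eq_big => [M|M _]; first by rewrite inE.
rewrite -big_mkcond /=.
case: ifPn => [/fintype.subsetP ME|].
  by rewrite -prodr_const; apply: eq_bigr => i /ME iE; rewrite /F iE.
by move=> /subsetPn[i iM /negPf iE]; rewrite (bigD1 i) //= /F iE mul0r.
Qed.

(** * The hard instances: graphs made of optional disjoint edges *)

Section PairGraph.
Variables (m n : nat) (e : 'I_m * bool -> 'I_n).
Hypothesis e_inj : injective e.
Implicit Types (x : {ffun 'I_m -> bool}) (v : 'I_n).

(* The pairs [{e (i, true), e (i, false)}] are disjoint; [x i] decides whether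
   the [i]-th one is an edge. *)
Definition pair_graph x : adj_list n := fun v =>
  if [pick p | e p == v] is Some (i, b) then
    if x i then [:: e (i, ~~ b)] else [::]
  else [::].

Lemma pair_graph_e x i b :
  pair_graph x (e (i, b)) = if x i then [:: e (i, ~~ b)] else [::].
Proof.
rewrite /pair_graph; case: pickP => [[j c]|/(_ (i, b))]; last by rewrite eqxx.
by move=> /eqP /e_inj [-> ->].
Qed.

Lemma mem_pair_graph x v w :
  reflect (exists i b, [/\ x i, v = e (i, b) & w = e (i, ~~ b)]) (w \in pair_graph x v).
Proof.
apply: (iffP idP) => [|[i [b [xi -> ->]]]]; last by rewrite pair_graph_e xi inE.
rewrite /pair_graph; case: pickP => // -[i b] /eqP <-.
by case: ifP => // xi; rewrite inE => /eqP ->; exists i, b.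
Qed.

Lemma pair_graph_valid x : valid_input (pair_graph x).
Proof.
split; last split.
- move=> v; rewrite /pair_graph; case: pickP => // -[i b] _; by case: ifP.
- move=> v; apply/mem_pair_graph => -[i [b [_ -> /e_inj]]].
  by case; case: b.
- move=> v w; apply/mem_pair_graph/mem_pair_graph => -[i [b [xi -> ->]]];
    by exists i, (~~ b); rewrite negbK.
Qed.

Definition pair_edge (i : 'I_m) : {set 'I_n} := [set e (i, true); e (i, false)]%SET.

Definition pair_edges x : {set {set 'I_n}} := [set pair_edge i | i in [pred i | x i]]%SET.

Lemma mem_pair_edge i v : (v \in pair_edge i) = (v == e (i, true)) || (v == e (i, false)).
Proof. by rewrite !inE. Qed.

Lemma pair_edge_meet i j v : v \in pair_edge i -> v \in pair_edge j -> i = j.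
Proof.
by rewrite !mem_pair_edge => /orP[] /eqP -> /orP[] /eqP /e_inj [].
Qed.

Lemma pair_edge_inj : injective pair_edge.
Proof.
move=> i j ij; have v : e (i, true) \in pair_edge i by rewrite mem_pair_edge eqxx.
by apply: (pair_edge_meet v); rewrite -ij.
Qed.

(** The potential edges are pairwise disjoint, so any selection of those present is a matching. *)
Lemma is_matching_pair_graph x M :
  is_matching (pair_graph x) M = (M \subset pair_edges x).
Proof.
apply/idP/idP => [/andP[/forallP ME _]|/fintype.subsetP ME].
  apply/fintype.subsetP => E EM; have := ME E; rewrite EM /=.
  move=> /existsP[u /existsP[v /andP[/mem_pair_graph[i [b [xi -> ->]]] /eqP ->]]].
  apply/imsetP; exists i; first by rewrite inE.
  by case: b; rewrite /pair_edge //= finset.setUC.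
apply/andP; split.
  apply/forallP => E; apply/implyP => /ME /imsetP[i xi ->].
  apply/existsP; exists (e (i, true)); apply/existsP; exists (e (i, false)).
  by rewrite eqxx andbT; apply/mem_pair_graph; exists i, true.
apply/finset.trivIsetP => E F /ME /imsetP[i _ ->] /ME /imsetP[j _ ->] ij.
rewrite -setI_eq0; apply/eqP/finset.setP => v; rewrite finset.in_setI finset.in_set0.
apply/negP => /andP[vi vj]; move: ij.
by rewrite (pair_edge_meet vi vj) eqxx.
Qed.

Lemma Zmatch_pair_graph (R : numFieldType) x (lam : R) :
  Zmatch (pair_graph x) lam = (1 + lam) ^+ ones x.
Proof.
rewrite /Zmatch (eq_bigl _ _ (is_matching_pair_graph x)) sum_powerset.
by rewrite card_imset //; exact: pair_edge_inj.
Qed.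

Lemma oracle_pair_graph (q : query n) : (0 < m)%N ->
  exists i (g : bool -> answer n), forall x, oracle (pair_graph x) q = g (x i).
Proof.
move=> m0.
have nbrs v : exists i (g : bool -> seq 'I_n), forall x, pair_graph x v = g (x i).
  rewrite /pair_graph; case: pickP => [[i b] _|_].
    by exists i, (fun c => if c then [:: e (i, ~~ b)] else [::]).
  (* A vertex in no pair is isolated, so any index will do; [m0] supplies one. *)
  by exists (Ordinal m0), (fun=> [::]).
case: q => [v|v k]; have [i [g gE]] := nbrs v; exists i.
- by exists (fun c => ADeg n (size (g c))) => x; rewrite /= gE.
- by exists (fun c => ANbr (nth None (map Some (g c)) k)) => x; rewrite /= gE.
Qed.

End PairGraph.

(** * Executions as iterated steps *)

Section Runs.
Variables (n : nat) (R : Type) (A : det_alg n R) (L : adj_list n).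

(** A halted transcript is a fixed point, so a run is an [iter] of one map, as [adaptive_reading]
    expects. *)
Definition exec_step (h : seq (query n * answer n)) :=
  if A h is Ask q then rcons h (q, oracle L q) else h.

Lemma exec_iter k : exec A L k = iter k exec_step [::].
Proof. by elim: k => //= k ->; rewrite /exec_step; case: (A _). Qed.

Lemma exec_halted j k r : A (exec A L j) = Out n r -> (j <= k)%N ->
  A (exec A L k) = Out n r.
Proof.
move=> Aj /subnK <-; elim: (k - j)%N => [|i IH]; first by rewrite add0n.
by rewrite addSn /= IH.
Qed.

End Runs.

(** The strict bound by [T.+1] means halting within [T] queries; the transcript is frozen from then
    on, so the good output is the one seen at time [T]. *)
Lemma good_output_exec (n : nat) (R : realType) (A : det_alg n R) (L : adj_list n)
    (lam eps : R) (T : nat) :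
  good_output A L lam eps -> (qcount A L < T.+1%:R%:E)%E ->
  exists2 r, A (exec A L T) = Out n r & `|r - ln (Zmatch L lam)| <= eps * n%:R.
Proof.
move=> [k [r [Ak rE]]]; rewrite /qcount; case: pselect => // h.
case: ex_minnP => j jh _; rewrite lte_fin ltr_nat ltnS => jT.
have [s As] : exists s, A (exec A L j) = Out n s.
  by move: jh; rewrite /halted; case: (A _) => // s _; exists s.
have := exec_halted As jT => AT; exists r => //.
case: (leqP k T) => [kT|/ltnW Tk]; first exact: exec_halted Ak kT.
by move: Ak; rewrite (exec_halted AT Tk) AT.
Qed.

(** A run that has not stopped passes neither [above] nor [below], and strictness makes the two
    tests exclusive. *)
Definition above (n : nat) (R : realType) (theta : R) (a : action n R) : bool :=
  if a is Out r then theta < r else false.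

Definition below (n : nat) (R : realType) (theta : R) (a : action n R) : bool :=
  if a is Out r then r < theta else false.

(** * Indistinguishability of the two biases *)

Section Discrimination.
Variables (R : realType) (m n : nat) (e : 'I_m * bool -> 'I_n).
Hypotheses (e_inj : injective e) (m_gt0 : (0 < m)%N).
Variables (A : det_alg n R) (T : nat) (d t : R).
Hypothesis t_gt0 : 0 < t.

(** Under fair bits the two exclusive tests have total probability at most [1]; each passage to bias
    [d] or [- d] costs half of the bracket. *)
Lemma threshold_test_le (theta : R) :
  mean (bias d) (fun x => (above theta (A (exec A (pair_graph e x) T)))%:R)
  + mean (bias (- d)) (fun x => (below theta (A (exec A (pair_graph e x) T)))%:R)
  <= 1 + (t * ((1 + 4 * d ^+ 2) ^+ T - 1) + t^-1).
Proof.
set hi := fun x => _; set lo := fun x => _.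
pose step x := exec_step A (pair_graph e x).
have one_bit s : exists i (g : bool -> seq (query n * answer n)),
    forall x, step x s = g (x i).
  rewrite /step /exec_step; case: (A s) => [q|r].
    have [i [g gE]] := oracle_pair_graph e q m_gt0.
    by exists i, (fun b => rcons s (q, g b)) => x; rewrite gE.
  by exists (Ordinal m_gt0), (fun=> s).
have hiE u : mean u hi = mean u (fun x => (above theta (A (iter T (step x) [::])))%:R).
  by apply: eq_mean => x; rewrite /hi exec_iter.
have loE u : mean u lo = mean u (fun x => (below theta (A (iter T (step x) [::])))%:R).
  by apply: eq_mean => x; rewrite /lo exec_iter.
have := adaptive_reading (fun h => above theta (A h)) d T [::] one_bit t_gt0.
have := adaptive_reading (fun h => below theta (A h)) (- d) T [::] one_bit t_gt0.
rewrite -!hiE -!loE sqrrN.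
have : mean (bias 0) hi + mean (bias 0) lo <= 1.
  rewrite -meanD -[leRHS](@mean1 _ m (@bias _ m 0)) => [|i]; last exact: bias_sum.
  apply: le_mean => [i b|x]; first by rewrite bias_ge0// normr0 invr_ge0.
  rewrite /hi /lo /above /below; case: (A _) => [q|r]; rewrite ?addr0//.
  by case: (ltgtP theta r) => _; rewrite ?addr0 ?add0r.
have -> : (2 * t)^-1 = t^-1 / 2 by rewrite invfM mulrC.
lra.
Qed.

(** A success puts the output on the correct side of [theta] unless the number of ones deviates by
    at least [s]; Chebyshev bounds that deviation for each sign. *)
Lemma approximation_success_le (lam eps : R) (bp bm : {ffun 'I_m -> bool} -> bool) :
  0 < lam -> 0 < d <= 2^-1 -> 2 * (eps * n%:R) <= ln (1 + lam) * (d * m%:R) ->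
  let ok x := exists2 r, A (exec A (pair_graph e x) T) = Out n r &
    `|r - ln (Zmatch (pair_graph e x) lam)| <= eps * n%:R in
  (forall x, bp x -> ok x) -> (forall x, bm x -> ok x) ->
  mean (bias d) (fun x => (bp x)%:R) + mean (bias (- d)) (fun x => (bm x)%:R)
  <= 1 + (t * ((1 + 4 * d ^+ 2) ^+ T - 1) + t^-1) + 2 / (d ^+ 2 * m%:R).
Proof.
move=> lam0 /andP[d0 d2] gap ok okp okm.
have c0 : 0 < ln (1 + lam) by rewrite ln_gt0// ltrDl.
have m0 : 0 < m%:R :> R by rewrite ltr0n.
have lnZ x : ln (Zmatch (pair_graph e x) lam) = ln (1 + lam) * (ones x)%:R.
  by rewrite Zmatch_pair_graph// lnXn ?mulr_natr// addr_gt0.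
have nd : `|d| <= 2^-1 by rewrite gtr0_norm.
have nd' : `|- d| <= 2^-1 by rewrite normrN.
(* Half the shift [d * m] of the mean number of ones: the other half, scaled by [ln (1 + lam)],
   absorbs the error [eps * n] by [gap]. *)
pose s := d * m%:R / 2.
have s0 : 0 < s by rewrite divr_gt0 ?mulr_gt0.
pose theta := ln (1 + lam) * (m%:R / 2).
pose far d' (x : {ffun 'I_m -> bool}) := s <= `|(ones x)%:R - m%:R * (2^-1 + d')|.
have Cp := @chebyshev_ones _ m _ _ nd s0; have Cm := @chebyshev_ones _ m _ _ nd' s0.
have sE : m%:R / (4 * s ^+ 2) = (d ^+ 2 * m%:R)^-1.
  by rewrite /s; field; rewrite !gt_eqF.
rewrite sE in Cp Cm.
have := threshold_test_le theta.
set hi := fun x => _; set lo := fun x => _ => test.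
have Hp : mean (bias d) (fun x => (bp x)%:R) <=
    mean (bias d) hi + mean (bias d) (fun x => (far d x)%:R).
  rewrite -meanD; apply: le_mean => [i b|x]; first exact: bias_ge0.
  have [/okp[r rE]|_] := boolP (bp x); last by rewrite addr_ge0.
  rewrite /hi rE /above lnZ /far; case: (lerP s) => [_ _|]; first by rewrite lerDr.
  rewrite addr0 ltr_norml => /andP[+ _]; rewrite /s => h.
  rewrite ler_norml => /andP[+ _] => h'.
  have key : 0 < ln (1 + lam) * ((ones x)%:R - m%:R / 2 - d * m%:R / 2).
    by rewrite mulr_gt0//; lra.
  have -> : theta < r by rewrite /theta; lra.
  by [].
have Hm : mean (bias (- d)) (fun x => (bm x)%:R) <=
    mean (bias (- d)) lo + mean (bias (- d)) (fun x => (far (- d) x)%:R).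
  rewrite -meanD; apply: le_mean => [i b|x]; first exact: bias_ge0.
  have [/okm[r rE]|_] := boolP (bm x); last by rewrite addr_ge0.
  rewrite /lo rE /below lnZ /far; case: (lerP s) => [_ _|]; first by rewrite lerDr.
  rewrite addr0 ltr_norml => /andP[_]; rewrite /s => h.
  rewrite ler_norml => /andP[_] => h'.
  have key : 0 < ln (1 + lam) * (m%:R / 2 - d * m%:R / 2 - (ones x)%:R).
    by rewrite mulr_gt0//; lra.
  have -> : r < theta by rewrite /theta; lra.
  by [].
move: Cp Cm Hp Hm test; rewrite /far; lra.
Qed.

End Discrimination.

(** * Averaging over the randomness of the algorithm *)

Section Averaging.
Local Open Scope classical_set_scope.
Context (R : realType) (d : measure_display) (Omega : measurableType d)
  (P : probability Omega R).

(** Integrate the pointwise bound and exchange sum and integral. This is the easy half of Yao's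
    principle: a bound for every deterministic algorithm passes to randomised ones. *)
Lemma sum_probability_le (I : finType) (a : I -> R) (B : I -> set Omega) (p b : R) :
  (forall i, 0 <= a i) -> (forall i, measurable (B i)) ->
  (forall i, (p%:E <= P (B i))%E) ->
  (forall w, \sum_i a i * \1_(B i) w <= b) -> (\sum_i a i) * p <= b.
Proof.
move=> a0 mB pB Bb; rewrite -lee_fin.
have -> : (b%:E = \int[P]_w b%:E)%E.
  by rewrite integral_cst//= probability_setT mule1.
apply: (@le_trans _ _ (\int[P]_w (\sum_i (a i * \1_(B i) w)%:E))%E).
  rewrite ge0_integral_sum//=; first last.
  - by move=> i w _; rewrite lee_fin mulr_ge0.
  - move=> i; apply/measurable_EFinP; exact: measurable_funM.
  rewrite mulr_suml -sumEFin; apply: lee_sum => i _.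
  under eq_integral do rewrite EFinM.
  rewrite ge0_integralZl//=; last 2 first.
  - by apply/measurable_EFinP.
  - by rewrite lee_fin.
  rewrite integral_indic// setIT EFinM; apply: lee_wpmul2l; last exact: pB.
  by rewrite lee_fin.
apply: ge0_le_integral => //.
- by move=> w _; apply: sume_ge0 => i _; rewrite lee_fin mulr_ge0.
- apply: emeasurable_sum => i; apply/measurable_EFinP; exact: measurable_funM.
- by move=> w _; rewrite sumEFin lee_fin.
Qed.

(** By Markov's inequality [X >= a] has probability at most [q]; that event is removed from [G]. *)
Lemma probability_truncation (X : Omega -> \bar R) (G : set Omega) (p q a : R) :
  measurable_fun setT X -> (forall w, (0 <= X w)%E) -> measurable G ->
  0 < a -> (p%:E <= P G)%E -> (\int[P]_w X w <= (a * q)%:E)%E ->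
  ((p - q)%:E <= P (G `&` [set w | (X w < a%:E)%E]))%E.
Proof.
move=> mX X0 mG a0 pG IX.
have mF : measurable [set w | (X w < a%:E)%E].
  by rewrite -[X in measurable X]setTI; exact: emeasurable_fun_infty_o.
have mF' : measurable [set w | (a%:E <= X w)%E].
  by rewrite -[X in measurable X]setTI; exact: emeasurable_fun_c_infty.
have Fq : (P [set w | (a%:E <= X w)%E] <= q%:E)%E.
  rewrite -(@lee_pmul2l _ a%:E)// -EFinM; apply: le_trans IX.
  have := @le_integral_comp_abse _ _ _ P setT measurableT X a id.
  rewrite setTI.
  have -> : [set w | (a%:E <= `|X w|)%E] = [set w | (a%:E <= X w)%E].
    by apply/seteqP; split => w /=; rewrite gee0_abs.
  under eq_integral do rewrite gee0_abs//.
  by apply => //; exact: measurable_id.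
have : (P G <= P (G `&` [set w | (X w < a%:E)%E]) + P [set w | (a%:E <= X w)%E])%E.
  apply: (le_trans _ (measureU2 _ _ _)) => //; last exact: measurableI.
  apply: le_measure; rewrite ?inE//; first by apply: measurableU => //; exact: measurableI.
  by move=> w Gw; case: (ltP (X w) a%:E) => ?; [left|right].
move=> PG; rewrite EFinB leeBlDr//.
by apply: le_trans pG _; apply: le_trans PG _; rewrite leeD2l.
Qed.

End Averaging.

(** * Numerical choices and the lower bound *)

Lemma qcount_ge0 (n : nat) (R : realType) (A : det_alg n R) (L : adj_list n) :
  (0 <= qcount A L)%E.
Proof. by rewrite /qcount; case: pselect => h; rewrite ?lee_fin ?ler0n ?leey. Qed.

(** Meant for [q = (1 + 4 * delta^2)^T], [z = T * (4 * delta^2)] and the balancing parameter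
    [t = 10]; the hypotheses give [q <= 200 / 199]. *)
Lemma success_bound (R : realFieldType) (q z y : R) :
  1 <= q -> q * (1 - z) <= 1 -> z <= 200^-1 -> y <= 1 / 50 ->
  1 + (10 * (q - 1) + 10^-1) + y <= 12 / 10.
Proof.
move=> q1 qz z200 y50.
have : q * (1 - 200^-1) <= q * (1 - z) by rewrite ler_pM2l; lra.
lra.
Qed.

Lemma leq_triple_half n : (1 < n)%N -> (n <= 3 * n./2)%N.
Proof. lia. Qed.

(** Vertex [i] is paired with [i + n./2]; for odd [n] the last vertex stays alone. *)
Lemma disjoint_pairs n : exists e : 'I_n./2 * bool -> 'I_n, injective e.
Proof.
have lt_pair (p : 'I_n./2 * bool) : (p.1 + p.2 * n./2 < n)%N.
  by case: p => [[i /= im] []]; lia.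
exists (fun p => Ordinal (lt_pair p)) => -[i b] [j c] [] /=.
case: i j b c => [i im] [j jm] [] [] /= ij; try lia.
  by congr (_, _); apply: val_inj => /=; lia.
by congr (_, _); apply: val_inj => /=; lia.
Qed.

Local Open Scope classical_set_scope.

Theorem theorem2 (R : realType) (lam : R) (hlam : 0 < lam) :
  exists C c eps0 : R, 0 < C /\ 0 < c /\ 0 < eps0 /\
  forall (n : nat) (eps : R), (0 < n)%N ->
    C / Num.sqrt (n%:R) < eps -> eps < eps0 ->
  forall (d : measure_display) (Omega : measurableType d)
         (P : probability Omega R) (A : Omega -> det_alg n R),
    (forall L : adj_list n, valid_input L ->
       measurable_fun [set: Omega] ((fun w => qcount (A w) L) : Omega -> \bar R)) ->
    (forall L : adj_list n, valid_input L ->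
       measurable [set w | good_output (A w) L lam eps]) ->
    (forall L : adj_list n, valid_input L ->
       ((2 / 3 : R)%:E <= P [set w | good_output (A w) L lam eps])%E) ->
    exists L : adj_list n, valid_input L /\
      ((c / eps ^+ 2)%:E <= \int[P]_w qcount (A w) L)%E.
Proof.
have c0 : 0 < ln (1 + lam) by rewrite ln_gt0// ltrDl.
(* A bias [K * eps] shifts the mean of [ln Z] by [12 * eps * m], which dominates [2 * eps * n] since
   [n <= 3 * m]. *)
pose K := 12 / ln (1 + lam).
have K0 : 0 < K by rewrite divr_gt0.
(* In turn these give [delta^2 * n > 400], a query budget [1 / (800 * delta^2)] exceeded with
   probability at most [1/20], and [delta < 1/4]. *)
exists (20 / K), (20 * (800 * K ^+ 2))^-1, (4 * K)^-1.
have K2 : 0 < K ^+ 2 by rewrite exprn_gt0.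
split; first by rewrite divr_gt0.
split; first by rewrite invr_gt0; lra.
split; first by rewrite invr_gt0 mulr_gt0.
set c := (20 * _)^-1; have cE : c = (20 * (800 * K ^+ 2))^-1 by [].
clearbody c; move=> n eps n0 eps_lb eps_ub d Omega P A mq mg pg.
apply: contrapT => few.
have {}few (L : adj_list n) : valid_input L ->
    (\int[P]_w qcount (A w) L <= (c / eps ^+ 2)%:E)%E.
  move=> vL; rewrite leNgt; apply/negP => lt_q; apply: few; exists L; split => //.
  exact: ltW.
have n1 : 0 < n%:R :> R by rewrite ltr0n.
have sn0 : 0 < Num.sqrt n%:R :> R by rewrite sqrtr_gt0.
pose delta := K * eps.
have eps0 : 0 < eps by apply: le_lt_trans eps_lb; rewrite !divr_ge0// ltW.
have de0 : 0 < delta by rewrite mulr_gt0.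
have de1 : delta < 4^-1.
  move: eps_ub; rewrite -(ltr_pM2l K0) -/delta invfM.
  by rewrite mulrCA mulfV ?gt_eqF// mulr1.
have de2n : 400 < delta ^+ 2 * n%:R.
  have : 20 < delta * Num.sqrt n%:R.
    move: eps_lb; rewrite ltr_pdivrMr// ltr_pdivrMr//.
    by rewrite /delta; lra.
  move=> h; have : 20 ^+ 2 < (delta * Num.sqrt n%:R) ^+ 2.
    by rewrite ltrXn2r// ?nnegrE ?mulr_ge0 ?(ltW de0) ?(ltW sn0).
  by rewrite exprMn sqr_sqrtr ?ler0n//; lra.
have de2 : 0 < delta ^+ 2 by rewrite exprn_gt0.
(* [n = 1] would contradict [delta < 1/4] and [delta^2 * n > 400]; so at least one pair exists. *)
have n2 : (1 < n)%N.
  rewrite ltnNge; apply/negP => n_le1; have {}n_le1 : n = 1%N by apply/eqP; rewrite eqn_leq n_le1.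
  by move: de2n; rewrite n_le1 mulr1; nra.
have [e e_inj] := disjoint_pairs n.
set m := n./2 in e e_inj.
have m_gt0 : (0 < m)%N by rewrite half_gt0.
have nm : n%:R <= 3 * m%:R :> R by rewrite -natrM ler_nat leq_triple_half.
(* Markov is applied at [T.+1], which exceeds the budget; the reading bound uses [T], which does
   not. *)
pose T := Num.truncn (800 * delta ^+ 2)^-1.
have /truncn_itv/andP[Tle Tgt] : 0 <= (800 * delta ^+ 2)^-1.
  by rewrite invr_ge0; lra.
rewrite -/T in Tle Tgt.
pose B x := [set w | good_output (A w) (pair_graph e x) lam eps] `&`
  [set w | (qcount (A w) (pair_graph e x) < T.+1%:R%:E)%E].
have mB x : measurable (B x).
  have vx := pair_graph_valid e_inj x.
  apply: measurableI; first exact: mg.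
  by rewrite -[X in measurable X]setTI; apply: emeasurable_fun_infty_o => //; exact: mq.
have pB x : ((2 / 3 - 20^-1)%:E <= P (B x))%E.
  have vx := pair_graph_valid e_inj x.
  apply: probability_truncation => //.
  - exact: mq.
  - by move=> w; exact: qcount_ge0.
  - exact: mg.
  - exact: pg.
  apply: le_trans (few _ vx) _; rewrite lee_fin.
  have -> : c / eps ^+ 2 = (800 * delta ^+ 2)^-1 / 20.
    by rewrite cE /delta; field; rewrite !gt_eqF.
  by rewrite ler_pM2r ?invr_gt0// ltW.
pose a (x : {ffun 'I_m -> bool}) := weight (bias delta) x + weight (bias (- delta)) x : R.
have nde : `|delta| <= 2^-1 by rewrite gtr0_norm//; lra.
have nde' : `|- delta| <= 2^-1 by rewrite normrN.
have a0 (x : {ffun 'I_m -> bool}) : 0 <= a x.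
  by rewrite addr_ge0// weight_ge0// => i b; exact: bias_ge0.
have mean_weight u : (forall i : 'I_m, u i true + u i false = 1) ->
    \sum_x weight u x = 1 :> R.
  move=> u1; rewrite -(mean1 u1); apply: eq_bigr => x _; by rewrite mulr1.
have := sum_probability_le a0 mB pB.
move=> /(_ (12 / 10)).
rewrite big_split /= !mean_weight; try by move=> i; exact: bias_sum.
(* The weights [a] have total mass [2], so averaging would give [2 * (2/3 - 1/20) = 37/30 <= 12/10],
   which is absurd. *)
suff H w : \sum_x a x * \1_(B x) w <= 12 / 10 by move=> /(_ H); lra.
have okB (x : {ffun 'I_m -> bool}) : w \in B x ->
    exists2 r, A w (exec (A w) (pair_graph e x) T) = Out n r &
    `|r - ln (Zmatch (pair_graph e x) lam)| <= eps * n%:R.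
  by rewrite inE => -[gw qw]; exact: good_output_exec gw qw.
have t0 : 0 < 10 :> R by [].
have gap : 2 * (eps * n%:R) <= ln (1 + lam) * (delta * m%:R).
  have -> : ln (1 + lam) * (delta * m%:R) = 12 * (eps * m%:R).
    by rewrite /delta /K; field; rewrite gt_eqF.
  have : eps * n%:R <= eps * (3 * m%:R) by rewrite ler_pM2l.
  have : 0 <= eps * m%:R by rewrite mulr_ge0 ?ler0n// ltW.
  lra.
have de_itv : 0 < delta <= 2^-1 by rewrite de0; lra.
have := approximation_success_le e_inj m_gt0 t0 hlam de_itv gap okB okB.
have -> : \sum_x a x * \1_(B x) w = mean (bias delta) (fun x => (w \in B x)%:R) +
    mean (bias (- delta)) (fun x => (w \in B x)%:R).
  by rewrite -big_split; apply: eq_bigr => x _; rewrite /a mulrDl indicE.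
move=> /le_trans; apply.
have far : 2 / (delta ^+ 2 * m%:R) <= 1 / 50.
  rewrite ler_pdivrMr; last by apply: mulr_gt0 => //; rewrite ltr0n.
  have : delta ^+ 2 * n%:R <= delta ^+ 2 * (3 * m%:R) by rewrite ler_pM2l.
  lra.
have p0 : 0 <= 4 * delta ^+ 2 by rewrite mulr_ge0 // ltW.
have Td : T%:R * (4 * delta ^+ 2) <= 200^-1.
  have -> : 200^-1 = (800 * delta ^+ 2)^-1 * (4 * delta ^+ 2) :> R.
    by field; rewrite gt_eqF.
  by rewrite ler_pM2r// mulr_gt0.
apply: success_bound (expr1D_mul_le1 T p0) Td far.
by rewrite exprn_ege1// lerDl.
Qed.
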